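(* Let $\gamma_0$ be a simple closed curve in the $xy$-plane $\mathbb{R}^2$ with positive curvature. Let $\gamma$ be a smooth closed curve in $\mathbb{R}^{2,1}$ that is locally a graph over $\gamma_0$, and assume that $\gamma$ and its curvature vector are spacelike. If the torsion $\tau$ of $\gamma$ satisfies $\tau\ge 0$ everywhere (or $\tau\le 0$ everywhere), then $\tau\equiv 0$, and hence $\gamma$ lies in a plane.
   Context: $\mathbb{R}^{2,1}$ is $\mathbb{R}^3$ with coordinates $(x,y,t)$ and the Lorentzian metric $dx^2+dy^2-dt^2$; write $v\cdot w$ for the corresponding inner product and $|v|^2=v\cdot v$ (possibly negative). A vector $v$ is spacelike if $|v|^2>0$, and a curve is spacelike if its tangent vectors are. A simple closed curve $\gamma_0$ in $\mathbb{R}^2$ (smooth, regular) has positive curvature if, upon choosing its orientation suitably, its signed (Euclidean) curvature is strictly positive everywhere; it may then be parametrized $2\pi$-periodically by the angle $\theta$ of its unit tangent vector $(\cos\theta,\sin\theta)$. That the closed curve $\gamma$ is locally a graph over $\gamma_0$ means that $\gamma$ projects down to $\gamma_0$ but may wrap around the cylinder over $\gamma_0$ more than once: there are an integer $k\ge 1$ and a smooth function $h:\mathbb{R}\to\mathbb{R}$, periodic with period $2\pi k$, such that $\gamma(\theta)=(\gamma_0(\theta);h(\theta))$. The curvature vector of a spacelike curve parametrized by arc length $s$ is $\gamma''(s)$; it being spacelike means $|\gamma''(s)|^2>0$ for all $s$. The cross product in $\mathbb{R}^{2,1}$ is obtained from the usual cross product of $\mathbb{R}^3$ by changing the sign of the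 $t$-component. The torsion is, up to an overall sign convention, $\tau=\dfrac{(\gamma'\times\gamma'')\cdot\gamma'''}{|\gamma'\times\gamma''|^2}$, with cross product, inner product and $|\cdot|^2$ taken in $\mathbb{R}^{2,1}$. *)

(* Defs.v *)
From Stdlib Require Import Reals Lra.
From Coquelicot Require Import Coquelicot.
Open Scope R_scope.

Definition plane : Type := (R * R)%type.

(** Points and vectors [((x, y), t)] of Minkowski space R^{2,1}. *)
Definition space : Type := (plane * R)%type.

Definition cx (v : space) : R := fst (fst v).
Definition cy (v : space) : R := snd (fst v).
Definition ct (v : space) : R := snd v.

Definition smooth (f : R -> R) : Prop := forall n x, ex_derive_n f n x.

Definition periodic {A : Type} (p : R) (f : R -> A) : Prop :=
  forall u, f (u + p) = f u.

(** * Plane curves *)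

Definition smooth2 (c : R -> plane) : Prop :=
  smooth (fun u => fst (c u)) /\ smooth (fun u => snd (c u)).

Definition deriv2 (c : R -> plane) (u : R) : plane :=
  (Derive (fun r => fst (c r)) u, Derive (fun r => snd (c r)) u).

Definition norm2 (v : plane) : R := sqrt (fst v ^ 2 + snd v ^ 2).

Definition regular2 (c : R -> plane) : Prop :=
  forall u, deriv2 c u <> (0, 0).

Definition unit_tangent2 (c : R -> plane) (u : R) : plane :=
  (fst (deriv2 c u) / norm2 (deriv2 c u), snd (deriv2 c u) / norm2 (deriv2 c u)).

Definition signed_curvature (c : R -> plane) (u : R) : R :=
  (fst (deriv2 c u) * snd (deriv2 (deriv2 c) u)
   - snd (deriv2 c u) * fst (deriv2 (deriv2 c) u)) / norm2 (deriv2 c u) ^ 3.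

(** [c], defined on all of R, runs once around the curve on each period [L]. *)
Definition simple_closed_of_period (L : R) (c : R -> plane) : Prop :=
  0 < L /\ smooth2 c /\ regular2 c /\ periodic L c /\
  (forall u v, 0 <= u < L -> 0 <= v < L -> c u = c v -> u = v).

Definition simple_closed (c : R -> plane) : Prop :=
  exists L, simple_closed_of_period L c.

Definition reversed (c : R -> plane) (u : R) : plane := c (- u).

Definition positive_curvature (c : R -> plane) : Prop :=
  (forall u, 0 < signed_curvature c u) \/
  (forall u, 0 < signed_curvature (reversed c) u).

(** [c0] is the 2 PI-periodic reparametrization of [c] by the angle of the unit
    tangent vector; the change of parameter may reverse the orientation of [c]. *)
Definition tangent_angle_parametrization (c c0 : R -> plane) : Prop :=
  (exists phi : R -> R,
      smooth phi /\ (forall theta, Derive phi theta <> 0) /\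
      (forall theta, c0 theta = c (phi theta))) /\
  simple_closed_of_period (2 * PI) c0 /\
  (forall theta, unit_tangent2 c0 theta = (cos theta, sin theta)).

(** * Curves in R^{2,1} *)

Definition lorentz (v w : space) : R :=
  cx v * cx w + cy v * cy w - ct v * ct w.

Definition spacelike (v : space) : Prop := 0 < lorentz v v.

Definition cross (v w : space) : space :=
  (cy v * ct w - ct v * cy w,
   ct v * cx w - cx v * ct w,
   - (cx v * cy w - cy v * cx w)).

Definition smooth3 (g : R -> space) : Prop :=
  smooth (fun u => cx (g u)) /\ smooth (fun u => cy (g u)) /\
  smooth (fun u => ct (g u)).

Definition closed_curve (g : R -> space) : Prop :=
  exists p, 0 < p /\ periodic p g.

Definition deriv3 (f : R -> space) (u : R) : space :=
  (Derive (fun r => cx (f r)) u, Derive (fun r => cy (f r)) u,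
   Derive (fun r => ct (f r)) u).

Definition scale3 (a : R) (v : space) : space := (a * cx v, a * cy v, a * ct v).

Definition spacelike_curve (g : R -> space) : Prop :=
  forall u, spacelike (deriv3 g u).

Definition speed (g : R -> space) (u : R) : R :=
  sqrt (lorentz (deriv3 g u) (deriv3 g u)).

(** The derivative d/ds of a vector field [f] along the spacelike curve [g] with
    respect to the arc length s of [g], i.e. (1 / |g'|) d/du for an arbitrary
    parameter u; see [darc_arc_length] and [darc_unit_speed]. *)
Definition darc (g f : R -> space) (u : R) : space :=
  scale3 (/ speed g u) (deriv3 f u).

Definition unit_tangent (g : R -> space) : R -> space := darc g g.

Definition curvature_vector (g : R -> space) : R -> space :=
  darc g (unit_tangent g).

Definition torsion (g : R -> space) (u : R) : R :=
  let g1 := unit_tangent g u in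
  let g2 := curvature_vector g u in
  let g3 := darc g (curvature_vector g) u in
  lorentz (cross g1 g2) g3 / lorentz (cross g1 g2) (cross g1 g2).

Definition locally_graph_over (g : R -> space) (c : R -> plane) : Prop :=
  exists (c0 : R -> plane) (k : nat) (h : R -> R),
    tangent_angle_parametrization c c0 /\
    (1 <= k)%nat /\ smooth h /\ periodic (2 * PI * INR k) h /\
    (forall theta, g theta = (c0 theta, h theta)).

Definition lies_in_plane (g : R -> space) : Prop :=
  exists a b c d : R, (a, b, c) <> (0, 0, 0) /\
    forall u, a * cx (g u) + b * cy (g u) + c * ct (g u) = d.

Lemma darc_arc_length (g F : R -> space) (s : R -> R) (u : R) :
  spacelike_curve g ->
  is_derive s u (speed g u) ->
  ex_derive (fun r => cx (F r)) (s u) ->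
  ex_derive (fun r => cy (F r)) (s u) ->
  ex_derive (fun r => ct (F r)) (s u) ->
  darc g (fun r => F (s r)) u = deriv3 F (s u).
Proof.
intros Hg Hs Hx Hy Ht.
assert (Hp : speed g u <> 0).
{ apply Rgt_not_eq, sqrt_lt_R0, Hg. }
assert (E : forall f : R -> R, ex_derive f (s u) ->
  / speed g u * Derive (fun r => f (s r)) u = Derive f (s u)).
{ intros f Hf.
  rewrite Derive_comp; [| exact Hf | now exists (speed g u)].
  rewrite (is_derive_unique _ _ _ Hs); field; exact Hp. }
unfold darc, scale3, deriv3, cx, cy, ct in *; simpl.
now rewrite (E (fun r => fst (fst (F r)))), (E (fun r => snd (fst (F r)))),
  (E (fun r => snd (F r))).
Qed.

Lemma darc_unit_speed (g f : R -> space) (u : R) :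
  lorentz (deriv3 g u) (deriv3 g u) = 1 -> darc g f u = deriv3 f u.
Proof.
intros H; unfold darc, speed; rewrite H, sqrt_1, Rinv_1.
unfold scale3, deriv3, cx, cy, ct; simpl; now rewrite !Rmult_1_l.
Qed.

(* Main.v *)
Require Import Defs.
From Stdlib Require Import ZArith Reals Lra Lia.
From Coquelicot Require Import Coquelicot.
Open Scope R_scope.

(** Write [gamma = (x, y; h)] with parameter the tangent angle of the base curve
    and [r > 0] the radius of curvature of the base, so that
    [gamma' = r (cos, sin; q)] with [q = h' / r]. The derivative of
    [V = (cos, sin; q)] satisfies [V'' = - V + (0, 0, q + q'')], and the torsion
    comes out as [- (q + q'') / (r (1 - q^2 - q'^2))]; the denominator is positive
    because the curvature vector is spacelike ([torsion_formula]). So a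
    sign of the torsion is a sign of [q + q''].

    The same operator occurs in the geometry of the base: its support function
    [G], with respect to any origin, satisfies [G + G'' = r]. Integrating by parts
    over a period of [gamma],
    [0 = int h' = int r q = int (G + G'') q = int G (q + q'')].
    If the origin is put on the base, convexity makes [G] nonnegative, and
    positive except at the angle of the origin ([support_pos],
    [support_nonneg]). Hence an integrand of constant sign has integral zero, and
    [q + q'' = 0] ([slope_harmonic]). In the proof the integral is replaced by an
    explicit periodic antiderivative, which is monotone and thus constant.

    Finally [q = A cos + B sin] gives [h' = A x' + B y'], the derivative of the
    equation of a plane ([harmonic_slope_planar]). *)

(** Differentiates an expression in functions whose derivatives are among the
    hypotheses. *)
Ltac derive_from_hypotheses :=
  auto_derive;
  [ repeat split; try (eexists; eauto)
  | repeat match goal with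
    | |- context [Derive ?f ?u] =>
        let E := fresh in
        eassert (E : Derive f u = _) by (apply is_derive_unique; eauto);
        rewrite E; clear E
    end ].

(** * Periodic and monotone functions on the line *)

Lemma mean_value (f df : R -> R) (u v : R) :
  (forall t, is_derive f t (df t)) -> u < v ->
  exists t, f v - f u = df t * (v - u) /\ u < t < v.
Proof.
intros Hf Huv.
apply (MVT_cor2 f df u v Huv).
intros t _; apply is_derive_Reals, Hf.
Qed.

Lemma derivative_zero_constant (f df : R -> R) :
  (forall u, is_derive f u (df u)) -> (forall u, df u = 0) ->
  forall u, f u = f 0.
Proof.
intros Hf H0 u.
destruct (Rtotal_order u 0) as [H|[->|H]]; [|reflexivity|];
  destruct (mean_value f df _ _ Hf H) as [t [E _]];
  rewrite H0 in E; lra.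
Qed.

Lemma derivative_periodic (p : R) (f df : R -> R) :
  (forall u, is_derive f u (df u)) -> periodic p f -> periodic p df.
Proof.
intros Hf Hp u.
assert (H : is_derive f u (df (u + p))).
{ apply (is_derive_ext (fun r => f (r + p))); [intros r; apply Hp|].
  derive_from_hypotheses; ring. }
rewrite <- (is_derive_unique _ _ _ H); apply is_derive_unique, Hf.
Qed.

(** A nondecreasing function takes a single value between two points where it
    takes the same one, and such points surround every [u]. *)
Lemma monotone_periodic_derivative_zero (p : R) (f df : R -> R) :
  0 < p -> periodic p f ->
  (forall u, is_derive f u (df u)) -> (forall u, 0 <= df u) ->
  forall u, df u = 0.
Proof.
intros Hp0 Hp Hf Hdf u.
assert (Hmono : forall a b, a <= b -> f a <= f b).
{ intros a b [H| ->]; [|lra].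
  destruct (mean_value f df a b Hf H) as [t [E _]].
  assert (0 <= df t * (b - a)) by (apply Rmult_le_pos; [apply Hdf|lra]).
  lra. }
assert (Hends : f (u + p / 2) = f (u - p / 2)).
{ rewrite <- (Hp (u - p / 2)); f_equal; lra. }
rewrite <- (is_derive_unique _ _ _ (Hf u)).
rewrite (Derive_ext_loc f (fun _ => f (u - p / 2)) u);
  [apply Derive_const|].
assert (Hp2 : 0 < p / 2) by lra.
exists (mkposreal _ Hp2); intros v Hv.
apply Rabs_def2 in Hv; simpl in Hv.
unfold minus, plus, opp in Hv; simpl in Hv.
apply Rle_antisym; [rewrite <- Hends|]; apply Hmono; lra.
Qed.

Lemma periodic_INR {A : Type} (p : R) (f : R -> A) (n : nat) :
  periodic p f -> periodic (p * INR n) f.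
Proof.
intros Hp; induction n as [|n IH]; intros u.
- simpl; f_equal; ring.
- rewrite S_INR; replace (u + p * (INR n + 1)) with ((u + p) + p * INR n) by ring.
  now rewrite IH.
Qed.

Lemma periodic_representative {A : Type} (p : R) (f : R -> A) (a u : R) :
  0 < p -> periodic p f -> exists v, a < v <= a + p /\ f v = f u.
Proof.
intros Hp0 Hp.
assert (HZ : forall z, f (u - p * IZR z) = f u).
{ intros z; destruct (Z_le_gt_dec 0 z) as [Hz|Hz].
  - rewrite <- (periodic_INR p f (Z.to_nat z) Hp), INR_IZR_INZ, Z2Nat.id by exact Hz.
    f_equal; ring.
  - rewrite <- (periodic_INR p f (Z.to_nat (- z)) Hp u), INR_IZR_INZ, Z2Nat.id by lia.
    rewrite opp_IZR; f_equal; ring. }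
(* [up t - 1 <= t < up t] read at [t = (a - u) / p] *)
destruct (archimed ((a - u) / p)) as [H1 H2].
exists (u - p * IZR (- up ((a - u) / p))); split; [|apply HZ].
rewrite opp_IZR.
assert (E : p * ((a - u) / p) = a - u) by (field; lra).
apply (Rmult_lt_compat_l p) in H1; [|lra].
apply (Rmult_le_compat_l p) in H2; [|lra].
lra.
Qed.

(** * Support function of a convex curve *)

(** [r] is the radius of curvature of [(x, y)], as a function of the angle of
    the tangent vector. *)
Definition tangent_angle_curve (x y r : R -> R) : Prop :=
  forall u, is_derive x u (r u * cos u) /\ is_derive y u (r u * sin u) /\ 0 < r u.

(** The support function at [u] in the direction [(sin u, - cos u)] of the outer
    normal, with the origin moved to the point of parameter [s]. *)
Definition support (x y : R -> R) (s u : R) : R :=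
  (x u - x s) * sin u - (y u - y s) * cos u.

Definition support_deriv (x y : R -> R) (s u : R) : R :=
  (x u - x s) * cos u + (y u - y s) * sin u.

Lemma is_derive_support (x y r : R -> R) (s u : R) :
  tangent_angle_curve x y r ->
  is_derive (support x y s) u (support_deriv x y s u).
Proof.
intros Hc; destruct (Hc u) as [Hx [Hy _]]; unfold support, support_deriv.
derive_from_hypotheses; ring.
Qed.

(** [G'' = r - G]. *)
Lemma is_derive_support_deriv (x y r : R -> R) (s u : R) :
  tangent_angle_curve x y r ->
  is_derive (support_deriv x y s) u (r u - support x y s u).
Proof.
intros Hc; destruct (Hc u) as [Hx [Hy _]]; unfold support, support_deriv.
derive_from_hypotheses.
assert (E := sin2_cos2 u); unfold Rsqr in E.
replace (r u) with (r u * (sin u * sin u + cos u * cos u)) at 3 by (rewrite E; ring).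
ring.
Qed.

Lemma support_periodic (x y : R -> R) (p s : R) :
  periodic p x -> periodic p y -> sin p = 0 -> cos p = 1 ->
  periodic p (support x y s) /\ periodic p (support_deriv x y s).
Proof.
intros Hx Hy Hsin Hcos.
split; intros u; unfold support, support_deriv;
  rewrite Hx, Hy, sin_plus, cos_plus, Hsin, Hcos; ring.
Qed.

(** The height of the point of parameter [t] in the direction of the outer
    normal at [u] has derivative [r t * sin (u - t)]. Over the period from
    [u - 2 PI] to [u] it first decreases, until [u - PI], and then increases back
    to its initial value, so that it is smaller than that value in between. *)
Lemma support_pos (x y r : R -> R) (s u : R) :
  tangent_angle_curve x y r -> periodic (2 * PI) x -> periodic (2 * PI) y ->
  u - 2 * PI < s < u -> 0 < support x y s u.
Proof.
intros Hc Hpx Hpy Hs.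
set (E := fun t => x t * sin u - y t * cos u).
assert (HE : forall t, is_derive E t (r t * sin (u - t))).
{ intros t; destruct (Hc t) as [Hx [Hy _]]; unfold E.
  derive_from_hypotheses; rewrite sin_minus; ring. }
assert (Eu : support x y s u = E u - E s) by (unfold support, E; ring).
rewrite Eu.
destruct (Rle_lt_dec (u - PI) s) as [H|H].
- destruct (mean_value E _ s u HE) as [t [-> Ht]]; [lra|].
  apply Rmult_lt_0_compat; [|lra].
  apply Rmult_lt_0_compat; [apply Hc|apply sin_gt_0; lra].
- destruct (mean_value E _ (u - 2 * PI) s HE) as [t [Et Ht]]; [lra|].
  assert (Ep : E (u - 2 * PI) = E u).
  { unfold E; rewrite <- (Hpx (u - 2 * PI)), <- (Hpy (u - 2 * PI)).
    now replace (u - 2 * PI + 2 * PI) with u by ring. }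
  assert (Hsin : sin (u - t) < 0) by (apply sin_lt_0; lra).
  assert (Hneg : 0 < (r t * - sin (u - t)) * (s - (u - 2 * PI))).
  { apply Rmult_lt_0_compat; [|lra].
    apply Rmult_lt_0_compat; [apply Hc|lra]. }
  lra.
Qed.

(** By periodicity the point of parameter [s] may be taken within one turn before
    the point of contact. *)
Lemma support_nonneg (x y r : R -> R) (s u : R) :
  tangent_angle_curve x y r -> periodic (2 * PI) x -> periodic (2 * PI) y ->
  0 <= support x y s u.
Proof.
intros Hc Hpx Hpy.
assert (HPI := PI_RGT_0).
destruct (periodic_representative (2 * PI) (fun t => (x t, y t)) (u - 2 * PI) s)
  as [v [Hv Ev]]; [lra|intros t; now rewrite Hpx, Hpy|].
injection Ev as Ex Ey.
unfold support; rewrite <- Ex, <- Ey; fold (support x y v u).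
destruct (Req_dec v u) as [->|Hne]; [unfold support; right; ring|].
left; apply (support_pos x y r); auto; lra.
Qed.

(** * Slope of a graph over a convex curve *)

(** With [G] the support function, [r = G + G''] and Green's formula give
    [r q = (G' q - G q')' + G (q + q'')]. As [h' = r q], the periodic function
    [h - (G' q - G q')] has derivative [G (q + q'') >= 0], hence is constant, and
    the origin may be put on the curve so that [G > 0] at any given parameter.
    The conditions on [p] say that it is a whole number of turns. *)
Lemma slope_harmonic (x y r h q q1 q2 : R -> R) (p : R) :
  tangent_angle_curve x y r -> periodic (2 * PI) x -> periodic (2 * PI) y ->
  0 < p -> sin p = 0 -> cos p = 1 ->
  periodic p x -> periodic p y -> periodic p h -> periodic p q ->
  (forall u, is_derive h u (r u * q u)) ->
  (forall u, is_derive q u (q1 u)) -> (forall u, is_derive q1 u (q2 u)) ->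
  (forall u, 0 <= q u + q2 u) ->
  forall u, q u + q2 u = 0.
Proof.
intros Hc Hpx Hpy Hp Hsin Hcos Hx Hy Hh Hq Dh Dq Dq1 Hpos u0.
(* Any origin other than the point of parameter [u0] makes [G u0] positive. *)
set (s := u0 - PI).
destruct (support_periodic x y p s Hx Hy Hsin Hcos) as [HG HG1].
assert (Hq1 := derivative_periodic p q q1 Dq Hq).
assert (Z : support x y s u0 * (q u0 + q2 u0) = 0).
{ apply (monotone_periodic_derivative_zero p
    (fun u => h u - (support_deriv x y s u * q u - support x y s u * q1 u))
    (fun u => support x y s u * (q u + q2 u))).
  - exact Hp.
  - intros u; now rewrite Hh, HG, HG1, Hq, Hq1.
  - intros u.
    assert (D1 := is_derive_support x y r s u Hc).
    assert (D2 := is_derive_support_deriv x y r s u Hc).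
    derive_from_hypotheses; ring.
  - intros u; apply Rmult_le_pos; [apply (support_nonneg x y r)|]; auto. }
assert (HPI := PI_RGT_0).
assert (Hs : 0 < support x y s u0).
{ apply (support_pos x y r); auto; unfold s; lra. }
apply Rmult_integral in Z; destruct Z as [Z|Z]; [lra|exact Z].
Qed.

(** The solutions of [q + q'' = 0] are [A cos + B sin], since
    [q cos - q' sin] and [q sin + q' cos] are constant; then
    [h' = A x' + B y']. *)
Lemma harmonic_slope_planar (x y r h q q1 q2 : R -> R) :
  tangent_angle_curve x y r ->
  (forall u, is_derive h u (r u * q u)) ->
  (forall u, is_derive q u (q1 u)) -> (forall u, is_derive q1 u (q2 u)) ->
  (forall u, q u + q2 u = 0) ->
  exists A B d, forall u, h u - A * x u - B * y u = d.
Proof.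
intros Hc Dh Dq Dq1 H0.
assert (HA : forall u, q u * cos u - q1 u * sin u = q 0 * cos 0 - q1 0 * sin 0).
{ apply (derivative_zero_constant (fun u => q u * cos u - q1 u * sin u)
    (fun u => - (q u + q2 u) * sin u)); intros u; [|rewrite H0; ring].
  derive_from_hypotheses; ring. }
assert (HB : forall u, q u * sin u + q1 u * cos u = q 0 * sin 0 + q1 0 * cos 0).
{ apply (derivative_zero_constant (fun u => q u * sin u + q1 u * cos u)
    (fun u => (q u + q2 u) * cos u)); intros u; [|rewrite H0; ring].
  derive_from_hypotheses; ring. }
set (A := q 0 * cos 0 - q1 0 * sin 0) in HA.
set (B := q 0 * sin 0 + q1 0 * cos 0) in HB.
exists A, B, (h 0 - A * x 0 - B * y 0).
apply (derivative_zero_constant (fun u => h u - A * x u - B * y u)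
  (fun u => r u * (q u - A * cos u - B * sin u))); intros u.
- destruct (Hc u) as [Hx [Hy _]].
  derive_from_hypotheses; ring.
- rewrite <- (HA u), <- (HB u).
  assert (E := sin2_cos2 u); unfold Rsqr in E.
  replace (q u) with (q u * (sin u * sin u + cos u * cos u)) at 1
    by (rewrite E; ring).
  ring.
Qed.

(** * Torsion of a graph over a convex curve *)

(** The vector [a V + b V' + e (0, 0, 1)], where [V = (cos, sin; q)] is the
    tangent direction of the graph and [q1 = q']. *)
Definition frame_comb (q q1 : R -> R) (u a b e : R) : space :=
  (a * cos u - b * sin u, a * sin u + b * cos u, a * q u + b * q1 u + e).

(** [V'' = - V + (q + q'') (0, 0, 1)]. *)
Lemma deriv3_frame_comb (q q1 q2 a a1 b b1 : R -> R) (g : R -> space) :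
  (forall u, is_derive q u (q1 u)) -> (forall u, is_derive q1 u (q2 u)) ->
  (forall u, is_derive a u (a1 u)) -> (forall u, is_derive b u (b1 u)) ->
  (forall u, g u = frame_comb q q1 u (a u) (b u) 0) ->
  forall u, deriv3 g u =
    frame_comb q q1 u (a1 u - b u) (a u + b1 u) (b u * (q u + q2 u)).
Proof.
intros Dq Dq1 Da Db Hg u.
unfold deriv3, frame_comb, cx, cy, ct.
f_equal; [f_equal|]; apply is_derive_unique;
  eapply is_derive_ext; try (intros t; rewrite Hg; reflexivity);
  simpl; derive_from_hypotheses; ring.
Qed.

Lemma lorentz_frame_comb (q q1 : R -> R) (u a b : R) :
  lorentz (frame_comb q q1 u a b 0) (frame_comb q q1 u a b 0) =
  a ^ 2 + b ^ 2 - (a * q u + b * q1 u) ^ 2.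
Proof.
unfold lorentz, frame_comb, cx, cy, ct; simpl.
assert (E := sin2_cos2 u); unfold Rsqr in E.
replace (a * (a * 1) + b * (b * 1)) with
  ((a * a + b * b) * (sin u * sin u + cos u * cos u)) by (rewrite E; ring).
ring.
Qed.

Lemma cross_frame_comb (q q1 : R -> R) (u m a b c d e : R) :
  lorentz (cross (frame_comb q q1 u m 0 0) (frame_comb q q1 u a b 0))
    (frame_comb q q1 u c d e) = m * b * e.
Proof.
unfold lorentz, cross, frame_comb, cx, cy, ct; simpl.
assert (E := sin2_cos2 u); unfold Rsqr in E.
replace (m * b * e) with (m * b * e * (sin u * sin u + cos u * cos u))
  by (rewrite E; ring).
ring.
Qed.

Lemma cross_norm_frame_comb (q q1 : R -> R) (u m a b : R) :
  let n := cross (frame_comb q q1 u m 0 0) (frame_comb q q1 u a b 0) in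
  lorentz n n = (m * b) ^ 2 * (q u ^ 2 + q1 u ^ 2 - 1).
Proof.
unfold lorentz, cross, frame_comb, cx, cy, ct; simpl.
assert (E := sin2_cos2 u); unfold Rsqr in E.
replace (q u * (q u * 1) + q1 u * (q1 u * 1) - 1) with
  ((q u * q u + q1 u * q1 u) * (sin u * sin u + cos u * cos u)
   - (sin u * sin u + cos u * cos u) ^ 2) by (rewrite E; ring).
ring.
Qed.

Lemma scale3_frame_comb (q q1 : R -> R) (k u a b e : R) :
  scale3 k (frame_comb q q1 u a b e) = frame_comb q q1 u (k * a) (k * b) (k * e).
Proof.
unfold scale3, frame_comb, cx, cy, ct; simpl.
f_equal; [f_equal|]; ring.
Qed.

(** Writing [T = m V] with [m = 1 / sqrt (1 - q^2)] and [s' = r / m], one gets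
    [T' = m' V + m V'] with [m' = q q' m^3], so the curvature vector is
    [(m^2 / r) (m^2 q q' V + V')]. Its Lorentz square has the sign of
    [1 - q^2 - q'^2], and in the triple product only the [(0, 0, 1)]-component
    of the third derivative counts, a positive multiple of [q + q'']. The minus
    sign arises because the binormal direction is timelike. *)
Lemma torsion_formula (g : R -> space) (r r1 q q1 q2 : R -> R) :
  (forall u, 0 < r u) -> (forall u, is_derive r u (r1 u)) ->
  (forall u, is_derive q u (q1 u)) -> (forall u, is_derive q1 u (q2 u)) ->
  (forall u, deriv3 g u = frame_comb q q1 u (r u) 0 0) ->
  spacelike_curve g -> (forall u, spacelike (curvature_vector g u)) ->
  forall u, 0 < 1 - q u ^ 2 - q1 u ^ 2 /\
    torsion g u = - ((q u + q2 u) / (r u * (1 - q u ^ 2 - q1 u ^ 2))).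
Proof.
intros Hr Dr Dq Dq1 Hg Hsp Hk.
assert (Hq : forall u, 0 < 1 - q u ^ 2).
{ intros u; specialize (Hsp u); unfold spacelike in Hsp.
  rewrite Hg, lorentz_frame_comb in Hsp.
  replace (_ - _) with (r u ^ 2 * (1 - q u ^ 2)) in Hsp by ring.
  apply (Rmult_lt_reg_l (r u ^ 2)); [apply pow_lt, Hr|lra]. }
set (m := fun u => / sqrt (1 - q u ^ 2)).
assert (Hm : forall u, 0 < m u).
{ intros u; apply Rinv_0_lt_compat, sqrt_lt_R0, Hq. }
assert (Hm2 : forall u, m u ^ 2 = / (1 - q u ^ 2)).
{ intros u; unfold m; rewrite pow_inv, pow2_sqrt; [reflexivity|].
  left; apply Hq. }
assert (Hspeed : forall u, / speed g u = m u / r u).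
{ intros u; unfold speed; rewrite Hg, lorentz_frame_comb.
  replace (_ - _) with (r u ^ 2 * (1 - q u ^ 2)) by ring.
  rewrite sqrt_mult_alt, sqrt_pow2 by (try apply pow_le; left; apply Hr).
  unfold m, Rdiv; rewrite Rinv_mult; ring. }
assert (HT : forall u, unit_tangent g u = frame_comb q q1 u (m u) 0 0).
{ intros u; unfold unit_tangent, darc; rewrite Hspeed, Hg, scale3_frame_comb.
  f_equal; field; apply Rgt_not_eq, Hr. }
assert (Dm : forall u, is_derive m u (q u * q1 u * m u ^ 3)).
{ intros u; unfold m.
  assert (S := sqrt_lt_R0 _ (Hq u)).
  derive_from_hypotheses.
  - apply Hq.
  - apply Rgt_not_eq, S.
  - replace (q u * (q u * 1)) with (q u ^ 2) by ring.
    change (1 + - q u ^ 2) with (1 - q u ^ 2).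
    field; apply Rgt_not_eq, S. }
set (al := fun u => q u * q1 u * (/ (1 - q u ^ 2)) ^ 2 / r u).
set (be := fun u => / (1 - q u ^ 2) / r u).
assert (HK : forall u, curvature_vector g u = frame_comb q q1 u (al u) (be u) 0).
{ intros u; unfold curvature_vector, darc.
  rewrite (deriv3_frame_comb q q1 q2 m (fun u => q u * q1 u * m u ^ 3)
    (fun _ => 0) (fun _ => 0) (unit_tangent g) Dq Dq1 Dm (fun u => is_derive_const 0 u) HT).
  rewrite Hspeed, scale3_frame_comb; unfold al, be; rewrite <- Hm2.
  f_equal; field; apply Rgt_not_eq, Hr. }
assert (Hal : forall u, is_derive al u (Derive al u)).
{ intros u; apply Derive_correct; unfold al.
  auto_derive; specialize (Hq u); specialize (Hr u); simpl in *.
  repeat split; try (eexists; eauto); lra. }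
assert (Hbe : forall u, is_derive be u (Derive be u)).
{ intros u; apply Derive_correct; unfold be.
  auto_derive; specialize (Hq u); specialize (Hr u); simpl in *.
  repeat split; try (eexists; eauto); lra. }
intros u.
assert (Hru := Hr u); assert (Hmu := Hm u); assert (Hqu := Hq u).
assert (HD : 0 < 1 - q u ^ 2 - q1 u ^ 2).
{ specialize (Hk u); unfold spacelike in Hk.
  rewrite HK, lorentz_frame_comb in Hk.
  assert (E : al u ^ 2 + be u ^ 2 - (al u * q u + be u * q1 u) ^ 2 =
    ((/ (1 - q u ^ 2)) ^ 3 / r u ^ 2) * (1 - q u ^ 2 - q1 u ^ 2)).
  { unfold al, be; field; lra. }
  rewrite E in Hk.
  apply (Rmult_lt_reg_l ((/ (1 - q u ^ 2)) ^ 3 / r u ^ 2)); [|lra].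
  apply Rdiv_lt_0_compat; apply pow_lt; [apply Rinv_0_lt_compat|]; lra. }
split; [exact HD|].
unfold torsion; cbv zeta.
unfold darc; rewrite HT, HK.
rewrite (deriv3_frame_comb q q1 q2 al (Derive al) be (Derive be)
  (curvature_vector g) Dq Dq1 Hal Hbe HK).
rewrite Hspeed, scale3_frame_comb, cross_frame_comb, cross_norm_frame_comb.
unfold be.
field; repeat split; lra.
Qed.

(** * Slope of a smooth graph in terms of the tangent angle *)

Lemma smooth_is_derive (f : R -> R) (n : nat) (u : R) :
  smooth f -> is_derive (Derive_n f n) u (Derive_n f (S n) u).
Proof. intros Hf; apply Derive_correct, (Hf (S n) u). Qed.

(** When the unit tangent is [(cos u, sin u)], the speed of [c] is the linear
    combination [x' cos + y' sin] of its derivatives, which is visibly smooth. *)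
Lemma tangent_angle_derivatives (c : R -> plane) (u : R) :
  regular2 c -> unit_tangent2 c u = (cos u, sin u) ->
  let r := Derive (fun t => fst (c t)) u * cos u
           + Derive (fun t => snd (c t)) u * sin u in
  Derive (fun t => fst (c t)) u = r * cos u /\
  Derive (fun t => snd (c t)) u = r * sin u /\ 0 < r.
Proof.
intros Hreg Hu.
specialize (Hreg u).
unfold unit_tangent2, norm2, deriv2 in *; simpl fst in *; simpl snd in *.
set (X := Derive (fun t => fst (c t)) u) in *.
set (Y := Derive (fun t => snd (c t)) u) in *.
set (N := sqrt (X ^ 2 + Y ^ 2)) in *.
assert (HN : 0 < N).
{ apply sqrt_lt_R0.
  destruct (Req_dec X 0) as [HX|HX]; [destruct (Req_dec Y 0) as [HY|HY]|].
  - now rewrite HX, HY in Hreg.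
  - assert (0 < Y ^ 2) by now apply pow2_gt_0.
    assert (0 <= X ^ 2) by apply pow2_ge_0; lra.
  - assert (0 < X ^ 2) by now apply pow2_gt_0.
    assert (0 <= Y ^ 2) by apply pow2_ge_0; lra. }
injection Hu as HX HY.
assert (EX : X = N * cos u) by (rewrite <- HX; field; lra).
assert (EY : Y = N * sin u) by (rewrite <- HY; field; lra).
assert (ER : X * cos u + Y * sin u = N).
{ assert (E := sin2_cos2 u); unfold Rsqr in E.
  rewrite EX, EY; transitivity (N * (sin u * sin u + cos u * cos u)); [ring|].
  rewrite E; ring. }
cbv zeta; rewrite ER; auto.
Qed.

Lemma combination_twice_derivable (a a1 a2 b b1 b2 : R -> R) :
  (forall u, is_derive a u (a1 u)) -> (forall u, is_derive a1 u (a2 u)) ->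
  (forall u, is_derive b u (b1 u)) -> (forall u, is_derive b1 u (b2 u)) ->
  exists f1 f2,
    (forall u, is_derive (fun t => a t * cos t + b t * sin t) u (f1 u)) /\
    (forall u, is_derive f1 u (f2 u)).
Proof.
intros Da Da1 Db Db1.
exists (fun u => a1 u * cos u - a u * sin u + b1 u * sin u + b u * cos u).
eexists; split; intros u.
- derive_from_hypotheses; ring.
- apply Derive_correct; auto_derive; repeat split; try (eexists; eauto).
Qed.

Lemma quotient_twice_derivable (f f1 f2 r r1 r2 : R -> R) :
  (forall u, is_derive f u (f1 u)) -> (forall u, is_derive f1 u (f2 u)) ->
  (forall u, is_derive r u (r1 u)) -> (forall u, is_derive r1 u (r2 u)) ->
  (forall u, r u <> 0) ->
  exists q1 q2, (forall u, is_derive (fun t => f t / r t) u (q1 u)) /\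
                (forall u, is_derive q1 u (q2 u)).
Proof.
intros Df Df1 Dr Dr1 Hr.
exists (fun u => (f1 u * r u - f u * r1 u) / (r u * r u)).
eexists; split; intros u.
- derive_from_hypotheses; [apply Hr|field; apply Hr].
- apply Derive_correct; auto_derive; repeat split; try (eexists; eauto).
  now apply Rmult_integral_contrapositive.
Qed.

(** * Vanishing of the torsion *)

Theorem mainTheorem5 (gamma0 : R -> plane) (gamma : R -> space)
  (gamma0_simple_closed : simple_closed gamma0)
  (gamma0_curvature : positive_curvature gamma0)
  (gamma_smooth : smooth3 gamma)
  (gamma_closed : closed_curve gamma)
  (gamma_graph : locally_graph_over gamma gamma0)
  (gamma_spacelike : spacelike_curve gamma)
  (gamma_curvature : forall u, spacelike (curvature_vector gamma u))
  (torsion_sign : (forall u, 0 <= torsion gamma u) \/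
                  (forall u, torsion gamma u <= 0)) :
  (forall u, torsion gamma u = 0) /\ lies_in_plane gamma.
Proof.
destruct gamma_graph as [c [k [h [[_ [Hc Htan]] [Hk [Sh [Ph Hgam]]]]]]].
destruct Hc as [_ [[Sx Sy] [Hreg [Pc _]]]].
set (x := fun t => fst (c t)) in *.
set (y := fun t => snd (c t)) in *.
set (p := 2 * PI * INR k) in *.
assert (HPI := PI_RGT_0).
assert (Hp : 0 < p).
{ unfold p; apply Rmult_lt_0_compat; [lra|apply lt_0_INR; lia]. }
assert (Hsin : sin p = 0).
{ rewrite <- sin_0, <- (sin_period 0 k); f_equal; unfold p; ring. }
assert (Hcos : cos p = 1).
{ rewrite <- cos_0, <- (cos_period 0 k); f_equal; unfold p; ring. }
assert (Px : periodic (2 * PI) x) by (intros u; unfold x; now rewrite Pc).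
assert (Py : periodic (2 * PI) y) by (intros u; unfold y; now rewrite Pc).
assert (Px' := periodic_INR _ _ k Px : periodic p x).
assert (Py' := periodic_INR _ _ k Py : periodic p y).
assert (Dx := fun n u => smooth_is_derive x n u Sx).
assert (Dy := fun n u => smooth_is_derive y n u Sy).
assert (Dh := fun n u => smooth_is_derive h n u Sh).
set (r := fun u => Derive_n x 1 u * cos u + Derive_n y 1 u * sin u).
assert (Hxyr : forall u, Derive_n x 1 u = r u * cos u /\
                         Derive_n y 1 u = r u * sin u /\ 0 < r u).
{ intros u; apply (tangent_angle_derivatives c u Hreg (Htan u)). }
assert (Hr : forall u, 0 < r u) by (intros u; apply Hxyr).
assert (Hcurve : tangent_angle_curve x y r).
{ intros u; destruct (Hxyr u) as [Ex [Ey H]].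
  rewrite <- Ex, <- Ey; split; [apply (Dx 0%nat)|split; [apply (Dy 0%nat)|exact H]]. }
assert (Pr : periodic p r).
{ assert (P1 := derivative_periodic p _ _ (Dx 0%nat) Px').
  assert (P2 := derivative_periodic p _ _ (Dy 0%nat) Py').
  intros u; unfold r; rewrite P1, P2, cos_plus, sin_plus, Hsin, Hcos; ring. }
destruct (combination_twice_derivable _ _ _ _ _ _ (Dx 1%nat) (Dx 2%nat)
  (Dy 1%nat) (Dy 2%nat)) as [r1 [r2 [Dr Dr1]]].
fold r in Dr.
set (q := fun u => Derive_n h 1 u / r u).
destruct (quotient_twice_derivable _ _ _ r r1 r2 (Dh 1%nat) (Dh 2%nat) Dr Dr1)
  as [q1 [q2 [Dq Dq1]]].
{ intros u; apply Rgt_not_eq, Hr. }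
fold q in Dq.
assert (Dhq : forall u, is_derive h u (r u * q u)).
{ intros u; replace (r u * q u) with (Derive_n h 1 u).
  - apply (Dh 0%nat).
  - unfold q; field; apply Rgt_not_eq, Hr. }
assert (Pq : periodic p q).
{ intros u; unfold q.
  now rewrite (derivative_periodic p _ _ (Dh 0%nat) Ph u), Pr. }
assert (Hg1 : forall u, deriv3 gamma u = frame_comb q q1 u (r u) 0 0).
{ intros u; unfold deriv3, frame_comb.
  destruct (Hcurve u) as [Hx [Hy _]].
  f_equal; [f_equal|]; apply is_derive_unique.
  - apply (is_derive_ext x); [intros t; now rewrite Hgam|].
    now replace (_ - _) with (r u * cos u) by ring.
  - apply (is_derive_ext y); [intros t; now rewrite Hgam|].
    now replace (r u * sin u + _) with (r u * sin u) by ring.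
  - apply (is_derive_ext h); [intros t; now rewrite Hgam|].
    replace (_ + 0) with (r u * q u) by ring; apply Dhq. }
assert (Htor := torsion_formula gamma r r1 q q1 q2 Hr Dr Dq Dq1 Hg1
  gamma_spacelike gamma_curvature).
assert (Hsign : forall u, exists w, 0 < w /\ q u + q2 u = - torsion gamma u * w).
{ intros u; destruct (Htor u) as [HD ->].
  assert (Hru := Hr u).
  exists (r u * (1 - q u ^ 2 - q1 u ^ 2)); split.
  - now apply Rmult_lt_0_compat.
  - field; lra. }
assert (Hharm : forall u, q u + q2 u = 0).
{ destruct torsion_sign as [H|H].
  - (* The reflection [t -> - t] exchanges the two signs. *)
    assert (Hopp : forall u, - q u + - q2 u = 0).
    { apply (slope_harmonic x y r (fun u => - h u) (fun u => - q u)
        (fun u => - q1 u) (fun u => - q2 u) p); auto.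
      - intros u; now rewrite Ph.
      - intros u; now rewrite Pq.
      - intros u; derive_from_hypotheses; ring.
      - intros u; derive_from_hypotheses; ring.
      - intros u; derive_from_hypotheses; ring.
      - intros u; destruct (Hsign u) as [w [Hw E]].
        assert (Hm := Rmult_le_pos _ _ (H u) (Rlt_le _ _ Hw)); lra. }
    intros u; specialize (Hopp u); lra.
  - apply (slope_harmonic x y r h q q1 q2 p); auto.
    intros u; destruct (Hsign u) as [w [Hw ->]].
    apply Rmult_le_pos; [specialize (H u)|]; lra. }
split.
- intros u; destruct (Htor u) as [_ ->]; rewrite Hharm; unfold Rdiv; ring.
- destruct (harmonic_slope_planar x y r h q q1 q2 Hcurve Dhq Dq Dq1 Hharm)
    as [A [B [d Hd]]].
  exists (- A), (- B), 1, d; split; [intros E; injection E; lra|].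
  intros u; rewrite <- (Hd u), Hgam; unfold x, y, cx, cy, ct; simpl; ring.
Qed.
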